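(* Let $G$ be a nilpotent group of class two with $d(G) = n$. Then: (i) $d([G,G^{\varphi}]) \leq \dfrac{n(n^2+3n-1)}{3}$, where $[G,G^{\varphi}]$ is the subgroup of $\nu(G)$ (isomorphic to the non-abelian tensor square $G\otimes G$); (ii) $d(G\otimes^q G) \leq \dfrac{n(n^2+3n+2)}{3}$, for all integers $q \geq 0$; (iii) In particular, if $G$ has finite exponent $e(G)$ and $\gcd(q,e(G)) = 1$, then $d(G\otimes^q G) \leq n^2$.
   Context: $d(X)$ denotes the minimal number of generators of a group $X$. Conventions: $y^x = x^{-1}yx$, $[x,y] = x^{-1}y^{-1}xy$. The group $\nu(G)$. Let $G^{\varphi}$ be a copy of $G$ via an isomorphism $\varphi: g \mapsto g^{\varphi}$. Define $$\nu(G) = \langle G \cup G^{\varphi} \mid [g,h^{\varphi}]^k = [g^k,(h^k)^{\varphi}] = [g,h^{\varphi}]^{k^{\varphi}},\ \forall g,h,k \in G\rangle$$ (the relations of $G$ and of $G^{\varphi}$ being included). The group $\nu^q(G)$, $q \geq 0$. If $q \geq 1$, let $\widehat{\mathcal G} = \{\widehat{k} \mid k \in G\}$ be a set of symbols, one for each element of $G$; if $q=0$ let $\widehat{\mathcal G} = \emptyset$. Let $F(\widehat{\mathcal G})$ be the free group on $\widehat{\mathcal G}$, and let $J$ be the normal closure in the free product $\nu(G) * F(\widehat{\mathcal G})$ of the following elements, for all $\widehat k, \widehat{k_1} \in \widehat{\mathcal G}$ and $g,h \in G$: (1) $g^{-1}\,\widehat{k}\,g\,\widehat{(k^g)}^{-1}$;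 (2) $(g^{\varphi})^{-1}\,\widehat{k}\,g^{\varphi}\,\widehat{(k^g)}^{-1}$; (3) $(\widehat k)^{-1}[g,h^{\varphi}]\,\widehat k\,[g^{k^q},(h^{k^q})^{\varphi}]^{-1}$; (4) $(\widehat k)^{-1}\,\widehat{kk_1}\,(\widehat{k_1})^{-1}\bigl(\prod_{i=1}^{q-1}[k,(k_1^{-i})^{\varphi}]^{k^{q-1-i}}\bigr)^{-1}$; (5) $[\widehat k,\widehat{k_1}]\,[k^q,(k_1^q)^{\varphi}]^{-1}$; (6) $\widehat{[g,h]}\,[g,h^{\varphi}]^{-q}$. Then $\nu^q(G) := (\nu(G)*F(\widehat{\mathcal G}))/J$; for $q = 0$ this is $\nu(G)$. The groups $G$ and $G^{\varphi}$ embed in $\nu^q(G)$ and are identified with their images. $[G,G^{\varphi}]$ is the subgroup generated by all $[g,h^{\varphi}]$, $g,h\in G$; $\mathfrak G$ is the subgroup of $\nu^q(G)$ generated by the images of $\widehat{\mathcal G}$. The $q$-tensor square $G\otimes^q G$ is identified with the normal subgroup $\Upsilon^q(G) = [G,G^{\varphi}]\,\mathfrak G$ of $\nu^q(G)$; for $q=0$, $G\otimes^0 G = G\otimes G$ is the non-abelian tensor square. *)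

(* Defs.v *)
From HB Require Import structures.
From mathcomp Require Import all_boot all_order all_algebra all_classical.

Set Implicit Arguments.
Unset Strict Implicit.
Unset nuq_coverrinting Implicit Defensive.

Local Open Scope classical_set_scope.
Local Open Scope quotient_scope.
Local Open Scope group_scope.

(* Groups are arbitrary, possibly infinite: [groupType] of MathComp's monoid.v,
   where [x ^ y = y^-1 * (x * y)] and [[~ x, y] = x^-1 * (y^-1 * (x * y))].
   Subgroups are given as sets in the sense of classical_sets. *)

Section Subgroups.
Variable G : groupType.
Implicit Types (A B H : set G).

Definition is_subgroup H :=
  [/\ H 1, forall x y, H x -> H y -> H (x * y) & forall x, H x -> H x^-1].

Definition is_normal_subgroup H :=
  is_subgroup H /\ forall x y, H x -> H (x ^ y).

Definition generated A : set G := smallest is_subgroup A.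

Definition normal_closure A : set G := smallest is_normal_subgroup A.

Definition commutators A B : set G :=
  generated [set c | exists x y, [/\ A x, B y & c = [~ x, y]]].

(* [lower_central i] is usually written gamma_(i+1)(G). *)
Fixpoint lower_central (i : nat) : set G :=
  if i is j.+1 then commutators (lower_central j) [set: G] else [set: G].

(* [G] is nilpotent and its nilpotency class is exactly [c]. *)
Definition nilpotent_of_class (c : nat) :=
  lower_central c = [set 1] /\
  forall i, (i < c)%N -> lower_central i <> [set 1].

Definition generated_by_at_most H (m : nat) :=
  exists s : seq G, (size s <= m)%N /\ generated [set` s] = H.

(* The graph of the partial function d: [d H = m].  It is undefined when [H]
   is not finitely generated (or is not a subgroup). *)
Definition min_generators H (m : nat) :=
  generated_by_at_most H m /\
  forall k, generated_by_at_most H k -> (m <= k)%N.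

(* [G] has finite exponent, equal to [e]. *)
Definition has_exponent (e : nat) :=
  [/\ (0 < e)%N, forall g : G, g ^+ e = 1 &
      forall m, (0 < m)%N -> (forall g : G, g ^+ m = 1) -> (e <= m)%N].

End Subgroups.

(* The quotient of [H] by the normal closure of [A]. *)
Section QuotientByNormalClosure.
Variables (H : groupType) (A : set H).

Lemma normal_closure_normal : is_normal_subgroup (normal_closure A).
Proof.
split; first split.
- by move=> N [[[N1 _ _] _] _].
- move=> x y Ax Ay N NP; have [[[_ NM _] _] _] := NP.
  by apply: NM; [exact: Ax | exact: Ay].
- move=> x Ax N NP; have [[[_ _ NV] _] _] := NP.
  by apply: NV; exact: Ax.
- move=> x y Ax N NP; have [[_ NJ] _] := NP.
  by apply: NJ; exact: Ax.
Qed.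

Definition ncoset_rel : rel H := fun x y => `[< normal_closure A (x^-1 * y) >].

Lemma ncoset_relP : equiv_class_of ncoset_rel.
Proof.
have [[N1 NM NV] _] := normal_closure_normal; split.
- by move=> x; apply/asboolP; rewrite mulVg.
- by move=> x y; apply/asboolP/asboolP => /NV; rewrite invgM invgK.
- move=> y x z /asboolP xy /asboolP yz; apply/asboolP.
  by have := NM _ _ xy yz; rewrite -!mulgA mulVKg.
Qed.

Canonical ncoset_equiv := EquivRelPack ncoset_relP.

Definition quotient_ncl := {eq_quot ncoset_equiv}.
HB.instance Definition _ := Choice.on quotient_ncl.
HB.instance Definition _ := EqQuotient.on quotient_ncl.

Definition proj_ncl (x : H) : quotient_ncl := \pi x.

Lemma proj_ncl_eq x y :
  proj_ncl x = proj_ncl y <-> normal_closure A (x^-1 * y).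
Proof.
split; first by move/eqmodP/asboolP.
by move=> xy; apply/eqmodP/asboolP.
Qed.

Definition mul_ncl (a b : quotient_ncl) := proj_ncl (repr a * repr b).
Definition inv_ncl (a : quotient_ncl) := proj_ncl (repr a)^-1.

Lemma repr_ncl x : normal_closure A ((repr (proj_ncl x))^-1 * x).
Proof. by apply/proj_ncl_eq; rewrite /proj_ncl reprK. Qed.

Lemma proj_nclK a : proj_ncl (repr a) = a.
Proof. exact: reprK. Qed.

Lemma proj_nclM x y : proj_ncl (x * y) = mul_ncl (proj_ncl x) (proj_ncl y).
Proof.
apply/esym/proj_ncl_eq; have [[_ NM _] NJ] := normal_closure_normal.
set u := repr (proj_ncl x); set v := repr (proj_ncl y).
have vy : normal_closure A (v^-1 * y) by exact: repr_ncl.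
have ux : normal_closure A (u^-1 * x) by exact: repr_ncl.
have := NM _ _ (NJ _ v ux) vy.
by rewrite /conjg invgM -!mulgA mulVKg.
Qed.

Lemma proj_nclV x : proj_ncl x^-1 = inv_ncl (proj_ncl x).
Proof.
apply/esym/proj_ncl_eq; have [[_ _ NV] NJ] := normal_closure_normal.
have := NJ _ (repr (proj_ncl x))^-1 (NV _ (repr_ncl x)).
by rewrite /conjg !invgK invgM invgK -!mulgA mulgV mulg1.
Qed.

Lemma mul_nclA : associative mul_ncl.
Proof.
move=> a b c; rewrite -(proj_nclK a) -(proj_nclK b) -(proj_nclK c).
by rewrite -!proj_nclM mulgA.
Qed.

Lemma mul_1ncl : left_id (proj_ncl 1) mul_ncl.
Proof. by move=> a; rewrite -(proj_nclK a) -proj_nclM mul1g. Qed.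

Lemma mul_ncl1 : right_id (proj_ncl 1) mul_ncl.
Proof. by move=> a; rewrite -(proj_nclK a) -proj_nclM mulg1. Qed.

Lemma mul_Vncl : left_inverse (proj_ncl 1) inv_ncl mul_ncl.
Proof. by move=> a; rewrite -(proj_nclK a) -proj_nclV -proj_nclM mulVg. Qed.

Lemma mul_nclV : right_inverse (proj_ncl 1) inv_ncl mul_ncl.
Proof. by move=> a; rewrite -(proj_nclK a) -proj_nclV -proj_nclM mulgV. Qed.

HB.instance Definition _ := isGroup.Build quotient_ncl
  mul_nclA mul_1ncl mul_ncl1 mul_Vncl mul_nclV.

End QuotientByNormalClosure.

(* The free group on [X]: words in the letters [(x, false)] and
   [(x, true)] (standing for x and its inverse) up to cancellation. *)
Section FreeGroup.
Variable X : choiceType.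

Definition word := seq (X * bool).

Inductive word_eq : word -> word -> Prop :=
| word_eq_refl w : word_eq w w
| word_eq_sym w1 w2 : word_eq w1 w2 -> word_eq w2 w1
| word_eq_trans w1 w2 w3 : word_eq w1 w2 -> word_eq w2 w3 -> word_eq w1 w3
| word_eq_cancel u v x b : word_eq (u ++ (x, b) :: (x, ~~ b) :: v) (u ++ v).

Definition word_inv (w : word) : word := rev [seq (l.1, ~~ l.2) | l <- w].

Definition word_rel : rel word := fun w1 w2 => `[< word_eq w1 w2 >].

Lemma word_relP : equiv_class_of word_rel.
Proof.
split.
- by move=> x; apply/asboolP/word_eq_refl.
- by move=> x y; apply/asboolP/asboolP => /word_eq_sym.
- by move=> y x z /asboolP xy /asboolP yz; apply/asboolP/(word_eq_trans xy yz).
Qed.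

Canonical word_equiv := EquivRelPack word_relP.

Definition free_group := {eq_quot word_equiv}.
HB.instance Definition _ := Choice.on free_group.
HB.instance Definition _ := EqQuotient.on free_group.

Definition free_class (w : word) : free_group := \pi w.

Lemma free_class_eq w1 w2 : free_class w1 = free_class w2 <-> word_eq w1 w2.
Proof.
by split=> [/eqmodP/asboolP//|w12]; apply/eqmodP/asboolP.
Qed.

Lemma free_classK a : free_class (repr a) = a.
Proof. exact: reprK. Qed.

Lemma word_eq_catl u w1 w2 : word_eq w1 w2 -> word_eq (u ++ w1) (u ++ w2).
Proof.
elim=> [w|w3 w4 _|w3 w4 w5 _ h1 _|v1 v2 x b].
- exact: word_eq_refl.
- exact: word_eq_sym.
- exact: word_eq_trans.
- by rewrite !catA; exact: word_eq_cancel.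
Qed.

Lemma word_eq_catr u w1 w2 : word_eq w1 w2 -> word_eq (w1 ++ u) (w2 ++ u).
Proof.
elim=> [w|w3 w4 _|w3 w4 w5 _ h1 _|v1 v2 x b].
- exact: word_eq_refl.
- exact: word_eq_sym.
- exact: word_eq_trans.
- by rewrite -!catA; exact: (word_eq_cancel v1 (v2 ++ u)).
Qed.

Lemma word_eq_inv w1 w2 : word_eq w1 w2 -> word_eq (word_inv w1) (word_inv w2).
Proof.
elim=> [w|w3 w4 _|w3 w4 w5 _ h1 _|v1 v2 x b].
- exact: word_eq_refl.
- exact: word_eq_sym.
- exact: word_eq_trans.
- rewrite /word_inv !map_cat !rev_cat /= !rev_cons -!cats1 -!catA /=.
  by rewrite negbK; exact: word_eq_cancel.
Qed.

Lemma word_invK : involutive word_inv.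
Proof.
move=> w; rewrite /word_inv map_rev revK -map_comp -[RHS]map_id.
by apply: eq_map => -[x b] /=; rewrite negbK.
Qed.

Lemma word_eq_mulV w : word_eq (w ++ word_inv w) [::].
Proof.
elim: w => [|[x b] w IHw]; first exact: word_eq_refl.
rewrite /word_inv /= rev_cons -cats1 -/(word_inv w).
apply: (@word_eq_trans _ ([:: (x, b)] ++ [::] ++ [:: (x, ~~ b)])).
  apply: (word_eq_catl [:: (x, b)]); rewrite catA.
  exact: (word_eq_catr [:: (x, ~~ b)]).
exact: (@word_eq_cancel [::] [::]).
Qed.

Definition mul_free (a b : free_group) := free_class (repr a ++ repr b).
Definition inv_free (a : free_group) := free_class (word_inv (repr a)).

Lemma free_classM u v :
  free_class (u ++ v) = mul_free (free_class u) (free_class v).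
Proof.
apply/free_class_eq.
apply: (@word_eq_trans _ (repr (free_class u) ++ v)).
  by apply: word_eq_catr; apply/free_class_eq; rewrite free_classK.
by apply: word_eq_catl; apply/free_class_eq; rewrite free_classK.
Qed.

Lemma free_classV u : free_class (word_inv u) = inv_free (free_class u).
Proof.
by apply/free_class_eq/word_eq_inv/free_class_eq; rewrite free_classK.
Qed.

Lemma mul_freeA : associative mul_free.
Proof.
move=> a b c; rewrite -(free_classK a) -(free_classK b) -(free_classK c).
by rewrite -!free_classM catA.
Qed.

Lemma mul_1free : left_id (free_class [::]) mul_free.
Proof. by move=> a; rewrite -(free_classK a) -free_classM. Qed.

Lemma mul_free1 : right_id (free_class [::]) mul_free.
Proof. by move=> a; rewrite -(free_classK a) -free_classM cats0. Qed.

Lemma mul_freeV : right_inverse (free_class [::]) inv_free mul_free.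
Proof.
move=> a; rewrite -(free_classK a) -free_classV -free_classM.
exact/free_class_eq/word_eq_mulV.
Qed.

Lemma mul_Vfree : left_inverse (free_class [::]) inv_free mul_free.
Proof.
move=> a; rewrite -(free_classK a) -free_classV -free_classM.
by apply/free_class_eq; rewrite -{2}(word_invK (repr a)); exact: word_eq_mulV.
Qed.

HB.instance Definition _ := isGroup.Build free_group
  mul_freeA mul_1free mul_free1 mul_Vfree mul_freeV.

Definition free_gen (x : X) : free_group := free_class [:: (x, false)].

End FreeGroup.

(* The free product [H * K], presented on the disjoint union of [H] and [K] by
   the two multiplication tables. *)
Section FreeProduct.
Variables H K : groupType.

Variant free_product_relators : set (free_group (H + K)%type) :=
| free_product_rell x y : free_product_relators
    (free_gen (inl x) * free_gen (inl y) * (free_gen (inl (x * y)))^-1)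
| free_product_relr x y : free_product_relators
    (free_gen (inr x) * free_gen (inr y) * (free_gen (inr (x * y)))^-1).

Definition free_product : groupType := quotient_ncl free_product_relators.

Definition free_inl (x : H) : free_product := proj_ncl _ (free_gen (inl x)).
Definition free_inr (y : K) : free_product := proj_ncl _ (free_gen (inr y)).

End FreeProduct.

(* The copy of [G] is [G] itself, seen as the second factor of [G * G]. *)
Section Nu.
Variable G : groupType.

Local Notation i := (@free_inl G G).
Local Notation p := (@free_inr G G).

Variant nu_relators : set (free_product G G) :=
| nu_rel g h k : nu_relators
    ([~ i g, p h] ^ i k * [~ i (g ^ k), p (h ^ k)]^-1)
| nu_rel_phi g h k : nu_relators
    ([~ i (g ^ k), p (h ^ k)] * ([~ i g, p h] ^ p k)^-1).

Definition nu : groupType := quotient_ncl nu_relators.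

Definition nu_in (g : G) : nu := proj_ncl _ (i g).
Definition nu_phi (g : G) : nu := proj_ncl _ (p g).

(* [G, G^phi] in nu(G). *)
Definition nu_tensor : set nu :=
  generated [set c | exists g h, c = [~ nu_in g, nu_phi h]].

End Nu.

Section NuQ.
Variables (G : groupType) (q : nat).

(* One symbol for each element of [G] if [q > 0], no symbol if [q = 0]. *)
Definition hat_symbol : choiceType := {_ : G | (0 < q)%N}.

Definition hat_of (q_gt0 : (0 < q)%N) (k : G) : hat_symbol :=
  exist (fun=> (0 < q)%N) k q_gt0.

(* The free product nu(G) * F(hats), of which nu^q(G) is a quotient. *)
Definition nuq_cover : groupType := free_product (nu G) (free_group hat_symbol).
Definition cover_in (g : G) : nuq_cover := free_inl _ (nu_in g).
Definition cover_phi (g : G) : nuq_cover := free_inl _ (nu_phi g).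
Definition cover_hat (s : hat_symbol) : nuq_cover := free_inr _ (free_gen s).

Local Notation i := cover_in.
Local Notation p := cover_phi.
Local Notation hat q_gt0 k := (cover_hat (hat_of q_gt0 k)).

Variant nuq_relators : set nuq_cover :=
| nuq_rel1 (q_gt0 : (0 < q)%N) (g k : G) : nuq_relators
    ((i g)^-1 * hat q_gt0 k * i g * (hat q_gt0 (k ^ g))^-1)
| nuq_rel2 (q_gt0 : (0 < q)%N) (g k : G) : nuq_relators
    ((p g)^-1 * hat q_gt0 k * p g * (hat q_gt0 (k ^ g))^-1)
| nuq_rel3 (q_gt0 : (0 < q)%N) (g h k : G) : nuq_relators
    ((hat q_gt0 k)^-1 * [~ i g, p h] * hat q_gt0 k *
     [~ i (g ^ (k ^+ q)), p (h ^ (k ^+ q))]^-1)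
| nuq_rel4 (q_gt0 : (0 < q)%N) (k k1 : G) : nuq_relators
    ((hat q_gt0 k)^-1 * hat q_gt0 (k * k1) * (hat q_gt0 k1)^-1 *
     (\prod_(1 <= j < q)
        ([~ i k, p (k1 ^- j)] ^ (i k ^+ (q - 1 - j))))^-1)
| nuq_rel5 (q_gt0 : (0 < q)%N) (k k1 : G) : nuq_relators
    ([~ hat q_gt0 k, hat q_gt0 k1] * [~ i (k ^+ q), p (k1 ^+ q)]^-1)
| nuq_rel6 (q_gt0 : (0 < q)%N) (g h : G) : nuq_relators
    (hat q_gt0 [~ g, h] * [~ i g, p h] ^- q).

Definition nuq : groupType := quotient_ncl nuq_relators.

Definition nuq_in (g : G) : nuq := proj_ncl _ (i g).
Definition nuq_phi (g : G) : nuq := proj_ncl _ (p g).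
Definition nuq_hat (s : hat_symbol) : nuq := proj_ncl _ (cover_hat s).

(* [G, G^phi] in nu^q(G). *)
Definition nuq_tensor : set nuq :=
  generated [set c | exists g h, c = [~ nuq_in g, nuq_phi h]].

Definition nuq_hat_subgroup : set nuq := generated (range nuq_hat).

(* The q-tensor square, as the product of the two subgroups above. *)
Definition q_tensor_square : set nuq :=
  [set z | exists x y, [/\ nuq_tensor x, nuq_hat_subgroup y & z = x * y]].

End NuQ.

Arguments nu_tensor : clear implicits.
Arguments q_tensor_square : clear implicits.

(* Main.v *)
Require Import Defs.
From mathcomp Require Import all_boot all_order all_algebra all_classical.
From HB Require Import structures.
From mathcomp Require Import zify lra.

Set Implicit Arguments.
Unset Strict Implicit.
Unset Printing Implicit Defensive.

(** Write [tau g h] for [[~ g, h^phi]].  The theorem only uses that [tau] comes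
    from two homomorphisms [i], [p] from [G] to a group [V] such that
    conjugating [tau g h] by [i k], or by [p k], gives [tau (g ^ k) (h ^ k)];
    both nu(G) and nu^q(G) have this property ([nu_compatible],
    [nuq_compatible]).

    When [G] has class two, conjugation by [tau a b] acts on the elements [tau]
    as conjugation by the central element [[~ a, b]], so they all commute.
    Expanding [tau g (h * k) = tau g (k * h ^ k)] in two ways yields
      [tau (g ^ h) (k ^ h) = tau g k * tau [~ g, k] h]   ([tau_conj]),
    so [tau] is bilinear up to the values [tau [~ g, k] h].  These are
    trilinear and alternating in [g] and [k].  Exchanging the roles of [i] and
    [p] in [tau_conj] gives a second formula for the same element, whence
    [tau h [~ k, g] = tau [~ g, k] h]; with this symmetry, expanding
    [tau (g ^ h) (k ^ h)] once more, with [g ^ h = g * [~ g, h]] and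
    [k ^ h = k * [~ k, h]], turns [tau_conj] into a Jacobi identity
    ([tau_jacobi]).  Hence, for generators
    x_1, ..., x_n of [G], the subgroup generated by all [tau g h] is generated
    by the n^2 elements [tau x_i x_j] and by one element
    [tau [~ x_i, x_j] x_k] for each of the n (n^2 - 1) / 3 basic commutators of
    weight three ([tau_generators]).

    In nu^q(G) the symbol of a product is the product of the symbols up to
    [[G, G^phi]], so that n further generators of the q-tensor square, the
    symbols of the x_i, suffice ([hat_generated]).

    Suppose moreover that [G] has exponent e coprime to q.  Then [tau x x] has
    order dividing e because [tau] is linear on the powers of [x], and order
    dividing q because [tau g h ^+ q] is the symbol of [[~ g, h]]: it is trivial.
    Conjugation by the symbol of [c] acts as conjugation by [c ^+ q], so that
    [[~ tau a b, hat c]] is the q-th power of [tau [~ a, b] c]; as the latter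
    has order dividing e, it is a power of that commutator.  What remains is
    the n^2 - n elements [tau x_i x_j] with i <> j and the n symbols. *)

(** * Generated subgroups and numbers of generators *)

Section Generation.
Local Open Scope classical_set_scope.
Local Open Scope group_scope.
Variable G : groupType.
Implicit Types (A H : set G) (L : seq G).

Lemma generated_subgroup A : is_subgroup (generated A).
Proof.
split=> [M [[M1 _ _] _]|x y Ax Ay M HM|x Ax M HM]; first exact: M1.
  by have [[_ MM _] _] := HM; apply: MM; [exact: Ax | exact: Ay].
by have [[_ _ MV] _] := HM; apply: MV; exact: Ax.
Qed.

Lemma generated_sub H A : is_subgroup H -> A `<=` H -> generated A `<=` H.
Proof. exact: smallest_sub. Qed.

Lemma mem_generated L x : x \in L -> generated [set` L] x.
Proof. by move=> xL; apply: sub_gen_smallest. Qed.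

Lemma generated_eqP H L : is_subgroup H -> {in L, forall x, H x} ->
  H `<=` generated [set` L] -> generated [set` L] = H.
Proof.
by move=> HS LH HL; apply/seteqP; split=> //; apply: generated_sub.
Qed.

Lemma subgroup_conj H x y : is_subgroup H -> H x -> H y -> H (x ^ y).
Proof. by move=> [_ HM HV] Hx Hy; apply: (HM); [exact: HV|exact: HM]. Qed.

Lemma subgroup_expg H x n : is_subgroup H -> H x -> H (x ^+ n).
Proof.
by move=> [H1 HM _] Hx; elim: n => // n IHn; rewrite expgS; exact: HM.
Qed.

Lemma subgroup_coprime_expg H x q e : is_subgroup H ->
  (0 < q)%N -> coprime q e -> x ^+ e = 1 -> H (x ^+ q) -> H x.
Proof.
move=> HS q0 /eqP qe xe Hxq.
have [u v uv _] := egcdnP e q0.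
suff -> : x = (x ^+ q) ^+ u by exact: subgroup_expg.
by rewrite -expgnA mulnC uv qe addn1 expgSr mulnC expgnA xe expg1n mul1g.
Qed.

Lemma min_generators_exists H m : generated_by_at_most H m ->
  exists2 k, min_generators H k & (k <= m)%N.
Proof.
move=> Hm; have ex : exists k, `[< generated_by_at_most H k >].
  by exists m; apply/asboolP.
case: (ex_minnP ex) => k /asboolP Hk kmin; exists k; last exact/kmin/asboolP.
by split=> // j Hj; apply/kmin/asboolP.
Qed.

Lemma min_generators_seq H n : min_generators H n ->
  exists2 s : seq G, size s = n & generated [set` s] = H.
Proof.
move=> [[s [sn sH]] nmin]; exists s => //.
by apply/eqP; rewrite eqn_leq sn; apply: nmin; exists s.
Qed.

Lemma nilpotent_class2P : nilpotent_of_class G 2 ->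
  forall a b c : G, commute [~ a, b] c.
Proof.
move=> [G2 _] a b c; apply/commgP/eqP.
suff: @lower_central G 2 [~ [~ a, b], c] by rewrite G2.
apply: sub_gen_smallest; exists [~ a, b], c; split=> //.
by apply: sub_gen_smallest; exists a, b.
Qed.

End Generation.

(** * Pairs of homomorphisms with compatible conjugations *)

Section Morphisms.
Local Open Scope classical_set_scope.
Local Open Scope group_scope.

Lemma morph1 (H K : groupType) (f : H -> K) :
  {morph f : x y / x * y} -> f 1 = 1.
Proof. by move=> fM; apply: (@mulgI _ (f 1)); rewrite -fM !mulg1. Qed.

Lemma preimage_subgroup (G V : groupType) (f : G -> V) (H : set V) :
  {morph f : x y / x * y} -> is_subgroup H -> is_subgroup (f @^-1` H).
Proof.
move=> fM [H1 HM HV].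
have f1 := morph1 fM.
split=> [|x y Hx Hy|x Hx]; rewrite /preimage /= ?f1 ?fM //; first exact: HM.
suff -> : f x^-1 = (f x)^-1 by exact: HV.
by apply: (@mulIg _ (f x)); rewrite -fM !mulVg.
Qed.

Lemma commMg (V : groupType) (x y z : V) : [~ x * y, z] = [~ x, z] ^ y * [~ y, z].
Proof. by rewrite /commg /conjg !invgM !mulgA ?mulgK ?mulgVK. Qed.

Lemma commgM (V : groupType) (x y z : V) : [~ x, y * z] = [~ x, z] * [~ x, y] ^ z.
Proof. by rewrite /commg /conjg !invgM !mulgA ?mulgK ?mulgVK. Qed.

Definition crossed_compatible (G V : groupType) (i p : G -> V) :=
  forall g h k, [~ i g, p h] ^ i k = [~ i (g ^ k), p (h ^ k)] /\
                [~ i g, p h] ^ p k = [~ i (g ^ k), p (h ^ k)].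

(** The compatibility condition does not distinguish the two homomorphisms,
    since exchanging them only inverts the commutators.  So every identity for
    [tau] has a mirror image. *)
Lemma crossed_compatible_sym (G V : groupType) (i p : G -> V) :
  crossed_compatible i p -> crossed_compatible p i.
Proof.
move=> ip g h k; have [hi hp] := ip h g k.
by rewrite -![[~ p _, i _]]invgR !conjVg hi hp.
Qed.

Lemma crossed_compatible_comp (G V W : groupType) (i p : G -> V)
    (f : UMagmaMorphism.type V W) :
  crossed_compatible i p -> crossed_compatible (f \o i) (f \o p).
Proof.
move=> ip g h k; have [hi hp] := ip g h k.
by rewrite /= -!(gmulfR f) -!(gmulfJ f) hi hp.
Qed.

End Morphisms.

(** * The commutator pairing of a group of class two *)

Section CrossedPairing.
Local Open Scope classical_set_scope.
Local Open Scope group_scope.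
Variables (G V : groupType) (i p : UMagmaMorphism.type G V).
Hypothesis ip : crossed_compatible i p.
Hypothesis G2 : forall a b c : G, commute [~ a, b] c.

Local Notation tau g h := [~ i g, p h].

Lemma conj_commg (x a b : G) : x ^ [~ a, b] = x.
Proof. by apply/conjg_fixP/commgP/commute_sym/G2. Qed.

Lemma commg_conj (a b x : G) : [~ a, b] ^ x = [~ a, b].
Proof. by apply/conjg_fixP/commgP/G2. Qed.

(** [a ^ b] differs from [a] by a central element. *)
Lemma conj_conj (x a b : G) : x ^ (a ^ b) = x ^ a.
Proof. by rewrite -[a ^ b](mulVKg a) -commgEl conjgM conj_commg. Qed.

Lemma tau1g h : tau 1 h = 1. Proof. by rewrite gmulf1 comm1g. Qed.
Lemma taug1 g : tau g 1 = 1. Proof. by rewrite gmulf1 commg1. Qed.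

Lemma tauMl g g' h : tau (g * g') h = tau (g ^ g') (h ^ g') * tau g' h.
Proof. by rewrite gmulfM commMg (ip _ _ _).1. Qed.

Lemma tauMr g h h' : tau g (h * h') = tau g h' * tau (g ^ h') (h ^ h').
Proof. by rewrite gmulfM commgM (ip _ _ _).2. Qed.

(** Conjugating by [[~ i a, p b]] conjugates both arguments of [tau] by
    [[~ a, b]], which is central. *)
Lemma tau_commute g h a b : commute (tau g h) (tau a b).
Proof.
apply/commgP; rewrite -conjg_fix {2}/commg 2![_ ^ (_ * _)]conjgM conjgM.
rewrite -!gmulfV /= (ip _ _ _).1 (ip _ _ _).2 (ip _ _ _).1 (ip _ _ _).2.
by rewrite -!conjgM -/(commg _ _) !conj_commg.
Qed.

Lemma tau_commgl g k h : tau [~ g, k] h = (tau g h)^-1 * tau (g ^ k) h.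
Proof.
rewrite (commgEl g k) tauMl !conj_conj; congr (_ * _).
by apply: (@mulIg _ (tau g h)); rewrite -tauMl !mulVg tau1g.
Qed.

(** Expand [tau g (h * k)] along both [h * k] and [k * h ^ k], and compare the
    results by [tau_commgl]. *)
Lemma tau_conj_conj g k h :
  tau (g ^ h) (k ^ h) = tau g k * tau [~ g, k] (h ^ k).
Proof.
have := tauMr g h k; rewrite conjgC tauMr !conj_conj => e.
by rewrite tau_commgl mulgA (commuteV (tau_commute _ _ _ _)) -mulgA -e mulKg.
Qed.

(** The instance of [tau_conj_conj] at the central element [h := [~ a, b]],
    where its left-hand side is [tau g k]. *)
Lemma tau_commg_commg g k a b : tau [~ g, k] [~ a, b] = 1.
Proof.
apply: (@mulgI _ (tau g k)); rewrite mulg1.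
by rewrite -[in LHS](commg_conj a b k) -tau_conj_conj !conj_commg.
Qed.

(** [h ^ k] and [h] differ by a commutator, which pairs trivially with
    [[~ g, k]] by [tau_commg_commg].  The factor [tau [~ g, k] h] is the whole
    defect of bilinearity of [tau]. *)
Lemma tau_conj g k h : tau (g ^ h) (k ^ h) = tau g k * tau [~ g, k] h.
Proof.
rewrite tau_conj_conj; congr (_ * _).
by rewrite -[h ^ k](mulVKg h) -commgEl tauMr tau_commg_commg mul1g !conj_commg.
Qed.

Lemma tau_commgMr g k h h' :
  tau [~ g, k] (h * h') = tau [~ g, k] h * tau [~ g, k] h'.
Proof.
rewrite tauMr tau_conj (_ : [~ [~ g, k], h] = 1) ?tau1g ?mulg1.
  exact: tau_commute.
by apply/eqP/commgP/G2.
Qed.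

Lemma tau_commgMl g g' k h :
  tau [~ g * g', k] h = tau [~ g, k] h * tau [~ g', k] h.
Proof. by rewrite commMg commg_conj tauMl !conj_commg. Qed.

Lemma tau_commg_inv g k h : tau [~ k, g] h = (tau [~ g, k] h)^-1.
Proof.
apply: (@mulIg _ (tau [~ g, k] h)); rewrite mulVg.
have := tauMl [~ k, g] [~ g, k] h.
by rewrite !conj_commg => <-; rewrite -(invgR g k) mulVg tau1g.
Qed.

Lemma tau_commgMm g k k' h :
  tau [~ g, k * k'] h = tau [~ g, k] h * tau [~ g, k'] h.
Proof.
by rewrite tau_commg_inv tau_commgMl invgM -!tau_commg_inv tau_commute.
Qed.

End CrossedPairing.

(** * The Jacobi identity and generators of the tensor part *)

Section TripleProducts.
Local Open Scope classical_set_scope.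
Local Open Scope group_scope.
Variables (G V : groupType) (i p : UMagmaMorphism.type G V).
Hypothesis ip : crossed_compatible i p.
Hypothesis G2 : forall a b c : G, commute [~ a, b] c.

Local Notation tau g h := [~ i g, p h].

(** [tau_conj] for the exchanged pair evaluates [tau (g ^ h) (k ^ h)] a second
    time. *)
Lemma tau_commgr g k h : tau h [~ k, g] = tau [~ g, k] h.
Proof.
apply: (@mulgI _ (tau g k)); rewrite -(tau_conj ip G2) (tau_commute ip G2).
rewrite -[tau (g ^ h) _]invgR (tau_conj (crossed_compatible_sym ip) G2).
by rewrite invgM !invgR.
Qed.

(** Expand [tau (a ^ c) (b ^ c)], with [a ^ c = a * [~ a, c]] and
    [b ^ c = b * [~ b, c]], along these central factors: the pair of
    commutators contributes nothing, and the term [tau a [~ b, c]] is turned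
    around by [tau_commgr]. *)
Lemma tau_jacobi a b c :
  tau [~ a, b] c = tau [~ c, b] a * tau [~ a, c] b.
Proof.
apply: (@mulgI _ (tau a b)); rewrite -(tau_conj ip G2).
rewrite -[a ^ c](mulVKg a) -commgEl -[b ^ c](mulVKg b) -commgEl.
rewrite (tauMl ip) !(conj_commg G2) (tauMr ip) !(conj_commg G2).
rewrite [X in _ * X](tauMr ip) !(conj_commg G2).
rewrite (tau_commg_commg ip G2) mul1g tau_commgr.
by rewrite (tau_commute ip G2) -!mulgA.
Qed.

(** The indices of the basic commutators of weight three in the entries of the
    sequence, listed by their earliest entry [x]. *)
Fixpoint jacobi_triples (s : seq G) : seq (G * G * G) :=
  if s is x :: s' then
    [seq (y, x, z) | y <- s', z <- s] ++ jacobi_triples s'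
  else [::].

Lemma jacobi_triples_cons x s :
  jacobi_triples (x :: s) =
    [seq (y, x, z) | y <- s, z <- x :: s] ++ jacobi_triples s.
Proof. by []. Qed.

Lemma size_jacobi_triples s :
  (3 * size (jacobi_triples s) + size s = size s ^ 3)%N.
Proof.
elim: s => // x s.
rewrite jacobi_triples_cons size_cat size_allpairs /= !expnS expn0; lia.
Qed.

Fixpoint off_diagonal (s : seq G) : seq (G * G) :=
  if s is x :: s' then
    [seq (x, y) | y <- s'] ++ [seq (y, x) | y <- s'] ++ off_diagonal s'
  else [::].

Lemma size_off_diagonal s : (size (off_diagonal s) + size s = size s ^ 2)%N.
Proof.
elim: s => //= x s; rewrite !size_cat !size_map /= !expnS expn0; lia.
Qed.

Lemma off_diagonal_cover s x y :
  x \in s -> y \in s -> x != y -> (x, y) \in off_diagonal s.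
Proof.
elim: s => //= z s IHs; rewrite !inE !mem_cat.
case/predU1P=> [->|xs]; case/predU1P=> [->|ys]; rewrite ?eqxx // => xy.
- by rewrite map_f.
- by rewrite (map_f (fun y => (y, z))) ?orbT.
- by rewrite IHs ?orbT.
Qed.

Section Generators.
Variable S : set V.
Hypothesis S_subgroup : is_subgroup S.

(** By induction on [s], with head [x].  Antisymmetry handles [x] in the first
    place.  When [x] occurs in the last place only, the Jacobi identity moves it into the inner commutators. *)
Lemma jacobi_triples_cover s :
  {in jacobi_triples s, forall w, S (tau [~ w.1.1, w.1.2] w.2)} ->
  forall a b c, a \in s -> b \in s -> c \in s -> S (tau [~ a, b] c).
Proof.
have [S1 SM SV] := S_subgroup.
elim: s => // x s IHs; rewrite jacobi_triples_cons => Sx.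
have Ss a b c : a \in s -> b \in s -> c \in s -> S (tau [~ a, b] c).
  by apply: IHs => w ws; apply: Sx; rewrite mem_cat ws orbT.
have Sxr a c : a \in s -> c \in x :: s -> S (tau [~ a, x] c).
  move=> a_s cs; apply: (Sx (a, x, c)).
  rewrite mem_cat; apply/orP; left.
  exact: (allpairs_f (fun y z => (y, x, z))).
have Sxl b c : b \in s -> c \in x :: s -> S (tau [~ x, b] c).
  by move=> bs cs; rewrite (tau_commg_inv ip G2); apply/SV/Sxr.
move=> a b c; rewrite [in a \in _]inE [in b \in _]inE.
case/predU1P=> [->|a_s]; case/predU1P=> [->|bs] cs; try by auto.
  by rewrite commgg tau1g.
move: cs; rewrite inE => /predU1P[->|]; last exact: Ss.
by rewrite tau_jacobi; apply: SM; [apply: Sxl|apply: Sxr];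
  rewrite // inE ?a_s ?bs orbT.
Qed.

Variable s : seq G.
Hypothesis Gs : generated [set` s] = [set: G].

Lemma generators_ind (P : set G) :
  is_subgroup P -> {in s, forall x, P x} -> forall x, P x.
Proof.
move=> HP sP x; suff: generated [set` s] `<=` P by rewrite Gs; exact.
by apply: generated_sub => // y; exact: sP.
Qed.

Lemma triples_generated :
  (forall a b c, a \in s -> b \in s -> c \in s -> S (tau [~ a, b] c)) ->
  forall a b c, S (tau [~ a, b] c).
Proof.
move=> Ss.
have Ss3 a b : a \in s -> b \in s -> forall c, S (tau [~ a, b] c).
  move=> a_s bs; apply: generators_ind => [|c cs]; last exact: Ss.
  apply: (@preimage_subgroup _ _ (fun c => tau [~ a, b] c)) => // x y.
  exact: tau_commgMr.
have Ss2 a : a \in s -> forall b c, S (tau [~ a, b] c).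
  move=> a_s b c; move: b; apply: generators_ind => [|b bs]; last exact: Ss3.
  apply: (@preimage_subgroup _ _ (fun b => tau [~ a, b] c)) => // x y.
  exact: tau_commgMm.
move=> a b c; move: a; apply: generators_ind => [|a a_s]; last exact: Ss2.
apply: (@preimage_subgroup _ _ (fun a => tau [~ a, b] c)) => // x y.
exact: tau_commgMl.
Qed.

(** Once all defects [tau [~ a, b] c] lie in [S], the expansions of [tau] along
    products and inverses in either argument stay in [S]. *)
Lemma tau_generated :
  (forall a b, a \in s -> b \in s -> S (tau a b)) ->
  (forall a b c, a \in s -> b \in s -> c \in s -> S (tau [~ a, b] c)) ->
  forall a b, S (tau a b).
Proof.
have [S1 SM SV] := S_subgroup.
move=> Ss /triples_generated St.
have SJ a b c : S (tau a b) -> S (tau (a ^ c) (b ^ c)).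
  by move=> Sab; rewrite (tau_conj ip G2); exact: SM.
have Sr a : a \in s -> forall b, S (tau a b).
  move=> a_s; apply: generators_ind => [|b bs]; last exact: Ss.
  split=> [|b c Sb Sc|b Sb]; first by rewrite /= taug1.
    by rewrite /= (tauMr ip); apply: SM; last exact: SJ.
  suff -> : tau a b^-1 = (tau (a ^ b^-1) (b ^ b^-1))^-1 by exact/SV/SJ.
  apply: (@mulIg _ (tau (a ^ b^-1) (b ^ b^-1))); rewrite mulVg.
  by rewrite -(tauMr ip) mulgV taug1.
move=> a b; move: a b; apply: generators_ind => [|a a_s b]; last exact: Sr.
split=> [b|a c Sa Sc b|a Sa b]; first by rewrite tau1g.
  by rewrite (tauMl ip); apply: SM => //; rewrite -[b](conjgKV c); exact/SJ.
suff -> : tau a^-1 b = (tau (a ^ a^-1) (b ^ a^-1))^-1 by exact/SV/SJ.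
apply: (@mulgI _ (tau (a ^ a^-1) (b ^ a^-1))); rewrite mulgV.
by rewrite -(tauMl ip) mulgV tau1g.
Qed.

End Generators.

Lemma tau_generators (s : seq G) : generated [set` s] = [set: G] ->
  exists2 L : seq V, (3 * size L + size s = size s ^ 3 + 3 * size s ^ 2)%N &
    generated [set` L] = generated [set c | exists g h, c = tau g h].
Proof.
move=> Gs.
exists ([seq tau a b | a <- s, b <- s] ++
        [seq tau [~ w.1.1, w.1.2] w.2 | w <- jacobi_triples s]).
  rewrite size_cat size_allpairs size_map mulnDr -addnA size_jacobi_triples.
  by rewrite addnC mulnn.
set L := (X in generated [set` X]).
have LS := generated_subgroup [set` L].
apply/seteqP; split; apply: generated_sub => //; first exact: generated_subgroup.
  move=> x; rewrite /= mem_cat => /orP[/allpairsP[w [_ _ ->]]|/mapP[w _ ->]];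
    apply: sub_gen_smallest; by do 2!eexists.
move=> _ [g [h ->]]; move: g h; apply: (tau_generated LS Gs) => [a b a_s bs|].
  by apply: mem_generated; rewrite mem_cat; apply/orP/or_introl/allpairs_f.
apply: (jacobi_triples_cover LS) => w ws; apply: mem_generated.
by rewrite mem_cat (map_f (fun w => tau [~ w.1.1, w.1.2] w.2)) ?orbT.
Qed.

End TripleProducts.

(** * The relations of nu(G) and of its q-analogue *)

Section Presentations.
Local Open Scope classical_set_scope.
Local Open Scope group_scope.

Lemma proj_ncl_relator (H : groupType) (A : set H) x : A x -> proj_ncl A x = 1.
Proof.
move=> Ax; apply/esym/proj_ncl_eq; rewrite invg1 mul1g.
exact: sub_gen_smallest.
Qed.

HB.instance Definition _ (H : groupType) (A : set H) :=
  isUMagmaMorphism.Build H (quotient_ncl A) (proj_ncl A) (erefl, @proj_nclM H A).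

Lemma proj_ncl_div (H : groupType) (A : set H) x y :
  A (x / y) -> proj_ncl A x = proj_ncl A y.
Proof. by move=> /proj_ncl_relator; rewrite gmulfF => /divg1_eq. Qed.

Lemma free_inlM (H K : groupType) : {morph @free_inl H K : x y / x * y}.
Proof.
move=> x y; apply/esym; apply: etrans (proj_ncl_div (@free_product_rell H K x y)).
exact/esym/gmulfM.
Qed.

Lemma free_inrM (H K : groupType) : {morph @free_inr H K : x y / x * y}.
Proof.
move=> x y; apply/esym; apply: etrans (proj_ncl_div (@free_product_relr H K x y)).
exact/esym/gmulfM.
Qed.

HB.instance Definition _ (H K : groupType) :=
  isUMagmaMorphism.Build H (free_product H K) (@free_inl H K)
    (morph1 (@free_inlM H K), @free_inlM H K).
HB.instance Definition _ (H K : groupType) :=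
  isUMagmaMorphism.Build K (free_product H K) (@free_inr H K)
    (morph1 (@free_inrM H K), @free_inrM H K).

HB.instance Definition _ (G : groupType) :=
  UMagmaMorphism.copy (@nu_in G) (proj_ncl (@nu_relators G) \o @free_inl G G).
HB.instance Definition _ (G : groupType) :=
  UMagmaMorphism.copy (@nu_phi G) (proj_ncl (@nu_relators G) \o @free_inr G G).

Lemma nu_compatible (G : groupType) : crossed_compatible (@nu_in G) (@nu_phi G).
Proof.
move=> g h k; split.
  have := proj_ncl_div (nu_rel g h k).
  by rewrite (gmulfJ (proj_ncl _)) !(gmulfR (proj_ncl _)) => e; exact: e.
have := proj_ncl_div (nu_rel_phi g h k).
by rewrite (gmulfJ (proj_ncl _)) !(gmulfR (proj_ncl _)) => e; exact: esym e.
Qed.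

End Presentations.

Section QTensorSquare.
Local Open Scope classical_set_scope.
Local Open Scope group_scope.
Variables (G : groupType) (q : nat).

HB.instance Definition _ := UMagmaMorphism.copy (@nuq_in G q)
  ((proj_ncl (@nuq_relators G q) \o @free_inl (nu G) (free_group (hat_symbol G q)))
     \o @nu_in G).
HB.instance Definition _ := UMagmaMorphism.copy (@nuq_phi G q)
  ((proj_ncl (@nuq_relators G q) \o @free_inl (nu G) (free_group (hat_symbol G q)))
     \o @nu_phi G).

Local Notation tau g h := [~ nuq_in q g, nuq_phi q h].

Lemma nuq_compatible : crossed_compatible (@nuq_in G q) (@nuq_phi G q).
Proof.
exact: (crossed_compatible_comp
  (proj_ncl (@nuq_relators G q) \o @free_inl (nu G) (free_group (hat_symbol G q)))
  (@nu_compatible G)).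
Qed.

Lemma tensor_subgroup : is_subgroup (@nuq_tensor G q).
Proof. exact: generated_subgroup. Qed.

Lemma tau_in_tensor g h : @nuq_tensor G q (tau g h).
Proof. by apply: sub_gen_smallest; exists g, h. Qed.

Section Hat.
Hypothesis q_gt0 : (0 < q)%N.

Definition hat (k : G) : nuq G q := nuq_hat (hat_of q_gt0 k).

Lemma tau_conj_hat g h k : tau g h ^ hat k = tau (g ^ (k ^+ q)) (h ^ (k ^+ q)).
Proof.
have := proj_ncl_div (nuq_rel3 q_gt0 g h k).
rewrite 2!(@gmulfM _ _ (proj_ncl _)) !(gmulfR (proj_ncl _)).
by rewrite (gmulfV (proj_ncl _)) => e; rewrite conjgE mulgA; exact: e.
Qed.

Lemma hatM_word k k1 :
  hat (k * k1) = hat k *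
    (\prod_(1 <= j < q) (tau k (k1 ^- j) ^ (nuq_in q k ^+ (q - 1 - j)))) *
    hat k1.
Proof.
have := proj_ncl_div (nuq_rel4 q_gt0 k k1).
rewrite 2!(@gmulfM _ _ (proj_ncl _)) !(gmulfV (proj_ncl _)) (gmulf_prod (proj_ncl _)).
under eq_bigr do rewrite (gmulfJ (proj_ncl _)) (gmulfR (proj_ncl _))
  (gmulfXn (proj_ncl _)).
by rewrite -/(hat _) => <-; rewrite !mulgA mulgVK mulgV mul1g.
Qed.

(** The correction factor of [hatM_word] is trivial for [k = k1 = 1], so that
    [hat 1] is idempotent. *)
Lemma hat1 : hat 1 = 1.
Proof.
have := hatM_word 1 1; rewrite big1 => [|j _].
  by rewrite !mulg1 -{1}[hat 1]mulg1 => /mulgI ->.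
by rewrite gmulf1 comm1g conj1g.
Qed.

Lemma hatM k k1 : exists2 w, @nuq_tensor G q w & hat (k * k1) = hat k * w * hat k1.
Proof.
have [T1 TM _] := tensor_subgroup.
eexists; last exact: hatM_word.
apply: big_ind => [//|//|j _].
by rewrite -gmulfXn /= (nuq_compatible _ _ _).1; apply: tau_in_tensor.
Qed.

Lemma hat_commg g h : hat [~ g, h] = tau g h ^+ q.
Proof.
have := proj_ncl_div (nuq_rel6 q_gt0 g h).
by rewrite (gmulfXn (proj_ncl _)) (gmulfR (proj_ncl _)).
Qed.

Lemma nuq_hatE (t : hat_symbol G q) : exists k, nuq_hat t = hat k.
Proof.
by case: t => k h; exists k; rewrite /hat /hat_of (bool_irrelevance q_gt0 h).
Qed.

(** Modulo [[G, G^phi]] the map [hat] is a homomorphism, so the elements whose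
    symbol lies in [S] form a subgroup. *)
Lemma hat_generated (S : set (nuq G q)) (s : seq G) :
  is_subgroup S -> generated [set` s] = [set: G] ->
  @nuq_tensor G q `<=` S -> {in s, forall x, S (hat x)} -> range (@nuq_hat G q) `<=` S.
Proof.
move=> [S1 SM SV] Gs TS Ss _ [t _ <-]; have [k ->] := nuq_hatE t.
move: k; apply: (generators_ind Gs) => //; split=> [|k k1 Sk Sk1|k Sk] /=.
- by rewrite hat1.
- by have [w /TS Sw ->] := hatM k k1; apply: (SM) => //; apply: (SM).
- have [w /TS Sw] := hatM k k^-1; rewrite mulgV hat1 => e.
  suff -> : hat k^-1 = (hat k * w)^-1 by apply/SV/SM.
  by apply: (@mulgI _ (hat k * w)); rewrite -e mulgV.
Qed.

End Hat.

(** * The q-tensor square *)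

(** In an infinite group, the elements that conjugate a subgroup into itself
    need not be closed under inverses; so both directions are tracked. *)
Lemma tensor_conj_hat (t : hat_symbol G q) x : @nuq_tensor G q x ->
  nuq_tensor (x ^ nuq_hat t) /\ nuq_tensor (x ^ (nuq_hat t)^-1).
Proof.
have q_gt0 : (0 < q)%N by case: t.
have [k ->] := nuq_hatE q_gt0 t.
have TS y : is_subgroup [set x : nuq G q | nuq_tensor (x ^ y)].
  apply: (@preimage_subgroup _ _ (fun x => x ^ y)); last exact: tensor_subgroup.
  by move=> ? ?; rewrite conjMg.
move=> Tx; split; move: x Tx; apply: (generated_sub (TS _)) => _ [g [h ->]] /=.
  by rewrite tau_conj_hat; apply: tau_in_tensor.
rewrite -[g](conjgKV (k ^+ q)) -[h](conjgKV (k ^+ q)) -(tau_conj_hat q_gt0) conjgK.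
exact: tau_in_tensor.
Qed.

Lemma tensor_conj_hat_subgroup x y :
  @nuq_tensor G q x -> nuq_hat_subgroup y -> nuq_tensor (x ^ y).
Proof.
move=> Tx Hy.
pose P : set (nuq G q) := [set y | forall x, nuq_tensor x ->
  nuq_tensor (x ^ y) /\ nuq_tensor (x ^ y^-1)].
suff /(_ y Hy x Tx)[] : @nuq_hat_subgroup G q `<=` P by [].
apply: generated_sub => [|_ [t _ <-] z]; last exact: tensor_conj_hat.
split=> [z Tz|a b Pa Pb z Tz|a Pa z /Pa[]]; last by rewrite invgK.
  by rewrite invg1 !conjg1.
have [[Ta _] [_ Tb]] := (Pa z Tz, Pb z Tz).
by rewrite invgM !conjgM; split; [have [] := Pb _ Ta|have [] := Pa _ Tb].
Qed.

Lemma q_tensor_square_subgroup : is_subgroup (q_tensor_square G q).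
Proof.
have [T1 TM TV] := tensor_subgroup.
have [H1 HM HV] := generated_subgroup (range (@nuq_hat G q)).
split=> [|_ _ [x [y [Tx Hy ->]]] [x' [y' [Tx' Hy' ->]]]|_ [x [y [Tx Hy ->]]]].
- by exists 1, 1; rewrite mulg1.
- exists (x * x' ^ y^-1), (y * y'); split; last 1 first.
  + by rewrite -[in LHS]mulgA [y * (_ * _)]mulgA (conjgCV y x') !mulgA.
  + by apply: (TM) => //; apply: tensor_conj_hat_subgroup => //; exact: HV.
  + exact: HM.
- exists (x^-1 ^ y), y^-1; split; last by rewrite invgM conjgE !mulgA mulgK.
  + by apply: tensor_conj_hat_subgroup => //; exact: TV.
  + exact: HV.
Qed.

Lemma sub_q_tensor_square :
  @nuq_tensor G q `<=` q_tensor_square G q /\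
  range (@nuq_hat G q) `<=` q_tensor_square G q.
Proof.
have [T1 _ _] := tensor_subgroup.
have HS := generated_subgroup (range (@nuq_hat G q)); have [H1 _ _] := HS.
split=> [x Tx|x Rx]; first by exists x, 1; rewrite mulg1.
by exists 1, x; rewrite mul1g; split=> //; apply: sub_gen_smallest.
Qed.

Lemma q_tensor_square_sub (S : set (nuq G q)) : is_subgroup S ->
  @nuq_tensor G q `<=` S -> range (@nuq_hat G q) `<=` S -> q_tensor_square G q `<=` S.
Proof.
move=> HS TS RS _ [x [y [/TS Sx Hy ->]]].
have [_ SM _] := HS; apply: SM => //.
by move: y Hy; exact: generated_sub.
Qed.

Hypothesis G2 : forall a b c : G, commute [~ a, b] c.
Variable s : seq G.
Hypothesis Gs : generated [set` s] = [set: G].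

Lemma q_tensor_square_generators :
  exists2 L : seq (nuq G q),
    (3 * size L + size s <= size s ^ 3 + 3 * size s ^ 2 + 3 * size s)%N &
    generated [set` L] = q_tensor_square G q.
Proof.
have [T HT] := sub_q_tensor_square.
have [L sL LT] := tau_generators nuq_compatible G2 Gs.
have LQ : {in L, forall x, q_tensor_square G q x}.
  by move=> x /mem_generated; rewrite LT => /T.
case: (posnP q) => [q0|q_gt0].
  exists L; first by rewrite sL leq_addr.
  apply: generated_eqP => //; first exact: q_tensor_square_subgroup.
  apply: q_tensor_square_sub; first exact: generated_subgroup.
    by rewrite LT.
  by move=> x [t _ _]; have [] : ~ (0 < q)%N by [rewrite q0]; case: t.
exists (L ++ [seq hat q_gt0 x | x <- s]).
  by rewrite size_cat size_map mulnDr addnAC sL.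
have LS := generated_subgroup [set` L ++ [seq hat q_gt0 x | x <- s]].
have LT' : @nuq_tensor G q `<=` generated [set` L ++ [seq hat q_gt0 x | x <- s]].
  rewrite /nuq_tensor -LT; apply: generated_sub => // x xL.
  by apply: mem_generated; rewrite mem_cat xL.
apply: generated_eqP; first exact: q_tensor_square_subgroup.
  move=> x; rewrite mem_cat => /orP[/LQ//|/mapP[k _ ->]].
  by apply: HT; exists (hat_of q_gt0 k).
apply: q_tensor_square_sub => //; apply: (hat_generated LS Gs) => // x xs.
by apply: mem_generated; rewrite mem_cat map_f ?orbT.
Qed.

(** * The case of an exponent coprime to q *)

Section Coprime.
Hypothesis q_gt0 : (0 < q)%N.
Variable e : nat.
Hypothesis Ge : forall g : G, g ^+ e = 1.
Hypothesis qe : coprime q e.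

(** The order of [tau g g] divides both e, by linearity on the powers of [g],
    and q, since the symbol of [[~ g, g] = 1] is trivial. *)
Lemma tau_diag (g : G) : tau g g = 1.
Proof.
have S1 : is_subgroup [set 1 : nuq G q].
  by split=> // [x y -> ->|x ->]; rewrite ?mulg1 ?invg1.
apply: (subgroup_coprime_expg S1 q_gt0 qe).
  suff -> : tau g g ^+ e = tau (g ^+ e) g by rewrite Ge tau1g.
  elim: (e) => [|m IHm]; first by rewrite tau1g.
  rewrite !expgS (tauMl nuq_compatible) -IHm; congr (_ * _).
  have gm : g ^ (g ^+ m) = g by apply/conjg_fixP/eqP/commgXg.
  by rewrite !gm.
by rewrite /= -(hat_commg q_gt0) commgg hat1.
Qed.

Lemma tau_commg_expg (a b c : G) m : tau [~ a, b] (c ^+ m) = tau [~ a, b] c ^+ m.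
Proof.
elim: m => [|m IHm]; first by rewrite taug1.
by rewrite !expgS (tau_commgMr nuq_compatible G2) IHm.
Qed.

(** The elements [tau [~ a, b] c] need no generators of their own: their q-th
    powers are the commutators of [tau a b] with the symbol of [c]. *)
Lemma q_tensor_square_generators_coprime :
  exists2 L : seq (nuq G q), size L = (size s ^ 2)%N &
    generated [set` L] = q_tensor_square G q.
Proof.
have [T HT] := sub_q_tensor_square.
exists ([seq tau w.1 w.2 | w <- off_diagonal s] ++ [seq hat q_gt0 x | x <- s]).
  by rewrite size_cat !size_map size_off_diagonal.
set L := _ ++ _.
have LS := generated_subgroup [set` L]; have [L1 LM LV] := LS.
have Lhat x : x \in s -> generated [set` L] (hat q_gt0 x).
  by move=> xs; apply: mem_generated; rewrite mem_cat map_f ?orbT.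
have Ltau a b : a \in s -> b \in s -> generated [set` L] (tau a b).
  move=> a_s bs; have [<-|ab] := eqVneq a b; first by rewrite tau_diag; exact: L1.
  apply: mem_generated; rewrite mem_cat.
  by rewrite (map_f (fun w => tau w.1 w.2) (off_diagonal_cover a_s bs ab)).
have LT : @nuq_tensor G q `<=` generated [set` L].
  apply: generated_sub => // _ [g [h ->]]; move: g h.
  apply: (tau_generated nuq_compatible G2 LS Gs) => // a b c a_s bs cs.
  apply: (subgroup_coprime_expg LS q_gt0 qe).
    by rewrite -tau_commg_expg Ge taug1.
  rewrite -tau_commg_expg.
  suff -> : tau [~ a, b] (c ^+ q) = (tau a b)^-1 * tau a b ^ hat q_gt0 c.
    apply: LM (LV _ (Ltau _ _ a_s bs)) _.
    exact: subgroup_conj LS (Ltau _ _ a_s bs) (Lhat _ cs).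
  by rewrite tau_conj_hat (tau_conj nuq_compatible G2) mulKg.
apply: generated_eqP; first exact: q_tensor_square_subgroup.
  move=> x; rewrite mem_cat => /orP[]/mapP[k _ ->].
    by apply: T; exact: tau_in_tensor.
  by apply: HT; exists (hat_of q_gt0 k).
by apply: q_tensor_square_sub => //; apply: (hat_generated LS Gs).
Qed.

End Coprime.
End QTensorSquare.

(** * Numbers of generators *)

Import GRing.Theory Num.Theory.
Local Open Scope ring_scope.

Theorem theorem3p2 (G : groupType) (n : nat)
    (hG : nilpotent_of_class G 2) (hn : min_generators [set: G]%classic n) :
  [/\ exists m : nat, min_generators (nu_tensor G) m /\
        m%:R <= n%:R * (n%:R ^+ 2 + 3 * n%:R - 1) / 3 :> rat,
      forall q : nat, exists m : nat,
        min_generators (q_tensor_square G q) m /\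
        m%:R <= n%:R * (n%:R ^+ 2 + 3 * n%:R + 2) / 3 :> rat
    & forall q e : nat, has_exponent G e -> gcdn q e = 1%N ->
        exists m : nat,
          min_generators (q_tensor_square G q) m /\ (m <= n ^ 2)%N].
Proof.
have G2 := nilpotent_class2P hG.
have [s <- Gs] := min_generators_seq hn.
split=> [|q|q e [e_gt0 Ge _] qe].
- have [L sL LT] := tau_generators (@nu_compatible G) G2 Gs.
  have [|m mT mL] := @min_generators_exists _ (nu_tensor G) (size L).
    by exists L.
  exists m; split=> //; rewrite ler_pdivlMr //.
  (* The bound multiplied by 3, over the natural numbers. *)
  have : (3 * m + size s <= size s ^ 3 + 3 * size s ^ 2)%N by lia.
  rewrite -(ler_nat rat) !natrD !natrX; lra.
- have [L sL LT] := q_tensor_square_generators q G2 Gs.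
  have [|m mT mL] := @min_generators_exists _ (q_tensor_square G q) (size L).
    by exists L.
  exists m; split=> //; rewrite ler_pdivlMr //.
  have : (3 * m + size s <= size s ^ 3 + 3 * size s ^ 2 + 3 * size s)%N by lia.
  rewrite -(ler_nat rat) !natrD !natrX; lra.
- have q_gt0 : (0 < q)%N.
    (* For q = 0 coprimality forces e = 1, and then [G] would be trivial. *)
    rewrite lt0n; apply/eqP => q0; move: qe; rewrite q0 gcd0n => e1.
    have [_ /(_ 0%N isT)[]] := hG; apply/seteqP; split=> // x _ /=.
    by have := Ge x; rewrite e1.
  have [L sL LT] := q_tensor_square_generators_coprime G2 Gs q_gt0 Ge (introT eqP qe).
  have [|m mT mL] := @min_generators_exists _ (q_tensor_square G q) (size L).
    by exists L.
  by exists m; split=> //; rewrite -sL.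
Qed.
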